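(* Let $(X_t)_{t \in \mathbb{N}}$ be a random process over $\mathbb{R}$, let $x_{\min} > 0$, and let $T = \inf\{t \mid X_t < x_{\min}\}$. Additionally, let $D$ denote the smallest real interval that contains $x_{\min}$ and at least all values $x \geq x_{\min}$ that, for all $t \leq T$, any $X_t$ can take. Furthermore, suppose that (a) $X_0 \geq x_{\min}$ and, for all $t \leq T$, it holds that $X_t \geq 0$, and that (b) there is a monotonically increasing function $h\colon D \to \mathbb{R}^+$ such that, for all $t < T$, we have $X_t - \mathrm{E}[X_{t+1} \mid X_0, \ldots, X_t] \geq h(X_t)$. Then $$\mathrm{E}[T \mid X_0] \leq \frac{x_{\min}}{h(x_{\min})} + \int_{x_{\min}}^{X_0} \frac{1}{h(z)} \,\mathrm{d}z.$$
   Context: $\mathbb{N}$ includes $0$; $\mathbb{R}^+$ denotes the positive reals. $\inf\emptyset := \infty$, so $T$ takes values in $\mathbb{N} \cup \{\infty\}$. The interval $D$ contains (at least) all possible values that the process can take while not having dropped below $x_{\min}$ yet. Conditional expectations given $X_0,\ldots,X_t$ (respectively $X_0$) are random variables, taken with respect to the $\sigma$-algebra generated by these variables; (in)equalities between random variables are understood almost surely. Since $T$ is a random variable, a requirement stated ''for all $t < T$'' (respectively ''for all $t \le T$'') means formally that, for every $t \in \mathbb{N}$, both sides of the inequality are multiplied by the indicator function of the event $\{t < T\}$ (respectively $\{t \le T\}$); i.e., the inequality only has to hold on that event. *)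

(* Defs.v *)
From HB Require Import structures.
From mathcomp Require Import all_boot all_order all_algebra.
From mathcomp Require Import all_classical all_reals all_analysis.
From mathcomp Require Import measurable_realfun.
Import Order.TTheory GRing.Theory Num.Theory.
Import numFieldNormedType.Exports.

Set Implicit Arguments.
Unset Strict Implicit.
Unset Printing Implicit Defensive.

Local Open Scope classical_set_scope.
Local Open Scope ring_scope.
Local Open Scope ereal_scope.

Section conditional_expectation.
Context d (W : measurableType d) (R : realType).
Implicit Types (P : probability W R) (G : set (set W)) (f Y : W -> \bar R).

(* [Y] is a version of the conditional expectation of the nonnegative [f] given
   the sigma-algebra generated by [G]; the value +oo is allowed, so [f] need not
   be integrable. *)
Definition is_ge0_cond_exp P G f Y :=
  [/\ measurable_fun (setT : set (g_sigma_algebraType G)) Y,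
      (forall w, 0 <= Y w) &
      forall A, <<s G >> A -> \int[P]_(w in A) Y w = \int[P]_(w in A) f w].

(* A version exists by [ge0_cond_expP] below, so the default is never used for
   measurable f >= 0. *)
Definition ge0_cond_exp P G f : W -> \bar R :=
  xget (cst 0) [set Y | is_ge0_cond_exp P G f Y].

(* E[f | G] = E[f^+ | G] - E[f^- | G]. This is meaningful wherever the two terms
   are not both +oo, without integrability of [f]. Where both are +oo, the value
   is the junk +oo - +oo = -oo. In the drift condition, X_{t+1} >= 0 a.s. on the
   event {t < T}, which belongs to the conditioning sigma-algebra, so there the
   negative part has null conditional expectation a.s. *)
Definition cond_exp P G f : W -> \bar R :=
  ge0_cond_exp P G f^\+ \- ge0_cond_exp P G f^\-.

End conditional_expectation.

Section cond_exp_exists.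
Context d (W : measurableType d) (R : realType).
Variables (P : probability W R) (G : set (set W)).
Hypothesis Gm : G `<=` measurable.

Let WG := g_sigma_algebraType G.

Lemma sub_g_sigma_measurable : <<s G >> `<=` @measurable _ W.
Proof. by apply: smallest_sub => //; exact: sigma_algebra_measurable. Qed.

Lemma measurable_fun_g_sigma d' (V : sigmaRingType d') (Y : W -> V) :
  measurable_fun (setT : set WG) Y -> measurable_fun (setT : set W) Y.
Proof.
by move=> mY _ B mB; apply: sub_g_sigma_measurable; exact: (mY measurableT B mB).
Qed.

Section integral_g_sigma.
Variable f : W -> \bar R.
Hypotheses (mf : measurable_fun setT f) (f0 : forall w, 0 <= f w)
           (foo : \int[P]_w f w < +oo).

Definition integral_g_sigma
  of measurable_fun setT f & (forall w, 0 <= f w) & \int[P]_w f w < +oo :=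
  fun A : set WG => \int[P]_(w in A) f w.

Local Notation nu := (integral_g_sigma mf f0 foo).

Let nu0 : nu set0 = 0. Proof. exact: integral_set0. Qed.

Let nu_ge0 A : 0 <= nu A. Proof. by apply: integral_ge0 => w _; exact: f0. Qed.

Let nu_sigma_additive : semi_sigma_additive nu.
Proof.
move=> F mF tF mUF; apply: semi_sigma_additive_nng_induced => //.
- by move=> n; exact: (sub_g_sigma_measurable (mF n)).
- exact: (sub_g_sigma_measurable mUF).
Qed.

HB.instance Definition _ :=
  isMeasure.Build _ _ _ nu nu0 nu_ge0 nu_sigma_additive.

Let nu_fin : fin_num_fun nu.
Proof.
move=> A mA; rewrite ge0_fin_numE//; apply: le_lt_trans foo.
by apply: ge0_subset_integral => //; exact: (sub_g_sigma_measurable mA).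
Qed.

HB.instance Definition _ := Measure_isFinite.Build _ _ _ nu nu_fin.

End integral_g_sigma.

Let idG (w : W) : WG := w.

Let midG : measurable_fun setT idG.
Proof. by move=> _ B mB; rewrite setTI; exact: (sub_g_sigma_measurable mB). Qed.

Lemma is_ge0_cond_exp_exists_finite f : measurable_fun setT f ->
  (forall w, 0 <= f w) -> \int[P]_w f w < +oo ->
  exists Y, is_ge0_cond_exp P G f Y.
Proof.
move=> mf f0 foo; pose nu := integral_g_sigma mf f0 foo.
have m1 : measurable_fun [set: W] (cst 1 : W -> \bar R).
  exact: measurable_cst.
have i1 : forall w : W, 0 <= (cst 1 w : \bar R) by move=> w; exact: lee01.
have i1oo : \int[P]_w (cst 1 w) < +oo.
  by rewrite integral_cst// mul1e; apply: le_lt_trans (probability_le1 P measurableT) (ltry 1).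
pose mu := integral_g_sigma m1 i1 i1oo.
have muP (A : set WG) : measurable A -> mu A = P A.
  move=> mA; rewrite /mu /integral_g_sigma integral_cst ?mul1e//.
  exact: (sub_g_sigma_measurable mA).
have [|Y [Y0 iY YE]] := @radon_nikodym_finite _ WG R mu nu.
  apply/null_content_dominatesP => A mA; move=> muA0; have PA0 : P A = 0 by rewrite -muP.
  apply: null_set_integral => //; first exact: (sub_g_sigma_measurable mA).
  exact: measurable_funTS.
have mY := measurable_int _ iY.
exists Y; split => // A mA.
have mA' := sub_g_sigma_measurable mA.
transitivity (\int[mu]_(w in A) Y w); last exact: esym (YE A mA).
symmetry.
rewrite (eq_measure_integral (pushforward P idG)); last by move=> B mB _; exact: muP.
by rewrite ge0_integral_pushforward//; exact: measurable_funTS.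
Qed.

Lemma is_ge0_cond_exp_exists f : measurable_fun setT f ->
  (forall w, 0 <= f w) -> exists Y, is_ge0_cond_exp P G f Y.
Proof.
move=> mf f0.
pose I := f @^-1` [set +oo].
pose E n := f @^-1` `[(n%:R)%:E, (n.+1%:R)%:E[%classic.
pose g n w := (f \_ (E n)) w + (\1_I w)%:E.
have mI : measurable I by rewrite -[I]setTI; exact: mf.
have mE n : measurable (E n).
  by rewrite -[E n]setTI; apply: mf => //; exact: emeasurable_itv.
have mg n : measurable_fun setT (g n).
  apply: emeasurable_funD; last exact/measurable_EFinP/measurable_indic.
  by apply/(measurable_restrictT _ (mE n)); exact: measurable_funTS.
have g0 n w : 0 <= g n w.
  by rewrite adde_ge0 ?lee_fin// /patch; case: ifP.
have goo n : \int[P]_w g n w < +oo.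
  apply: (@le_lt_trans _ _ (\int[P]_w (n.+1%:R + 1)%:E)); last first.
    by rewrite integral_cst// lte_mul_pinfty// ?lee_fin//;
      apply: le_lt_trans (probability_le1 P measurableT) (ltry 1).
  apply: ge0_le_integral => //.
  move=> w _; rewrite /g EFinD leeD//; last first.
    by rewrite lee_fin indicE; case: (_ \in _).
  rewrite /patch; case: ifPn => [|_]; last by rewrite lee_fin.
  by rewrite inE /E /= in_itv/= => /andP[_ /ltW].
have gE w : \sum_(n <oo) g n w = f w.
  case fw : (f w) (f0 w) => [r| |] // r0.
  - pose N := Num.truncn r.
    have gN k : g k w = if k == N then r%:E else 0.
      rewrite /g (_ : \1_I w = 0)%R ?adde0; last first.
        by rewrite indicE memNset// /I /= fw.
      rewrite /patch; have /(truncn_itv)/andP[Nr rN] : (0 <= r)%R by [].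
      have -> : (w \in E k) = (k == N); last by rewrite fw.
      apply/idP/idP => [|/eqP ->]; rewrite inE /E /= fw in_itv/= lee_fin lte_fin.
        by rewrite /N => /truncn_def/eqP; rewrite eq_sym.
      by rewrite Nr rN.
    apply: lim_near_cst => //; near=> n.
    rewrite (big_rem N)/=; last by rewrite mem_index_iota /=; near: n; exists N.+1.
    rewrite gN eqxx big_seq big1 ?adde0// => k; rewrite mem_rem_uniq ?iota_uniq//.
    by rewrite inE gN => /andP[/negbTE ->].
  - have gN k : g k w = 1.
      rewrite /g (_ : \1_I w = 1)%R; last by rewrite indicE mem_set// /I /= fw.
      by rewrite /patch memNset ?add0e// /E /= fw in_itv/= => /andP[_]; rewrite ltNge leey.
    apply/cvg_lim => //; rewrite (_ : (fun _ => _) = fun n => (n%:R : R)%:E).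
      exact/cvgenyP.
    apply/funext => n; under eq_bigr do rewrite gN.
    by rewrite sumEFin big_const_nat subn0 iter_addr_0.
have [Y YE] := choice (fun n => is_ge0_cond_exp_exists_finite (mg n) (g0 n) (goo n)).
have mY n : measurable_fun (setT : set WG) (Y n) by have [] := YE n.
have Y0 n w : 0 <= Y n w by have [] := YE n.
exists (fun w => \sum_(n <oo) Y n w); split.
- exact: (@ge0_emeasurable_sum _ WG).
- by move=> w; exact: nneseries_ge0.
- move=> A mA; have mA' := sub_g_sigma_measurable mA.
  rewrite integral_nneseries//; last first.
    by move=> n; apply: measurable_funTS; exact: measurable_fun_g_sigma.
  under eq_integral do rewrite -gE.
  rewrite integral_nneseries//; last by move=> n; exact: measurable_funTS.
  by apply: eq_eseriesr => n _; have [_ _ ->] := YE n.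
Unshelve. all: by end_near. Qed.

Lemma ge0_cond_expP f : measurable_fun setT f -> (forall w, 0 <= f w) ->
  is_ge0_cond_exp P G f (ge0_cond_exp P G f).
Proof.
move=> mf f0; have [Y YE] := is_ge0_cond_exp_exists mf f0.
exact: (@xgetI _ _ [set Y | is_ge0_cond_exp P G f Y] Y).
Qed.

End cond_exp_exists.

Section drift.
Context d (W : measurableType d) (R : realType) (P : probability W R).
Implicit Types (X : nat -> {RV P >-> R}) (xmin : R).

Definition history X (t : nat) : set (set W) :=
  g_sigma_preimage (fun i : 'I_t.+1 => (X i : W -> R)).

Lemma history_measurable X t : history X t `<=` measurable.
Proof.
apply: smallest_sub; first exact: sigma_algebra_measurable.
rewrite -bigcup_mkord_ord => A [i _ [B mB <-]].
exact: (measurable_funP (X (inord i : 'I_t.+1)) measurableT).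
Qed.

(* The hitting time inf {t | X_t < xmin}; note ereal_inf set0 = +oo. *)
Definition first_below X xmin (w : W) : \bar R :=
  ereal_inf [set (t%:R)%:E | t in [set t : nat | (X t w < xmin)%R]].

Definition reachable X xmin : set R :=
  [set x | (xmin <= x)%R /\
           exists t w, (t%:R)%:E <= first_below X xmin w /\ X t w = x].

(* The smallest interval containing xmin and the reachable values; [is_interval]
   covers all order-convex sets, bounded or not, open or closed at each end. *)
Definition drift_domain X xmin : set R :=
  smallest (@is_interval R) (xmin |` reachable X xmin).

End drift.

(* Main.v *)
Require Import Defs.
From HB Require Import structures.
From mathcomp Require Import all_boot all_order all_algebra.
From mathcomp Require Import all_classical all_reals all_analysis.
From mathcomp Require Import measurable_realfun.
From mathcomp Require Import lra.
Import Order.TTheory GRing.Theory Num.Theory.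
Import numFieldNormedType.Exports.

Set Implicit Arguments.
Unset Strict Implicit.
Unset Printing Implicit Defensive.

Local Open Scope classical_set_scope.
Local Open Scope ring_scope.
Local Open Scope ereal_scope.

(** The bound comes from a potential that turns the variable drift h into a drift
of size one. Let k = 1/h on the part of the drift domain above xmin, extended by
the constant 1/h(xmin) below xmin and by 0 beyond the domain. This k is
nonnegative and nonincreasing, so x |-> int_0^x k is nondecreasing and concave,
with tangent slope k(x) at x ([potential_concave]). Its value at a point
x >= xmin of the domain is exactly the claimed bound for X_0 = x ([potential_reciprocal_drift]).

On the event t < T, concavity at X_t gives
potential(X_(t+1)) <= potential(X_t) + (X_(t+1) - X_t) k(X_t). The factor k(X_t)
can be pulled out of the conditional expectation given the history
([integral_cond_exp_mul]), and the drift condition bounds the expected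
X_(t+1) - X_t by - h(X_t) = - 1/k(X_t). So the potential decreases by at least one
in expectation at each step before T. [potential_drift] states this in integrated
form: over an event of the history contained in t < T. No X_t is assumed
integrable, so all terms are kept nonnegative and the one cancellation of this
step, that of the integral of X_t k(X_t), is made after separating the case where it is
infinite; that integral is at most the integral of potential(X_t).

Telescoping over t on an event A of the sigma-algebra of X_0 bounds
sum_t P(A and t < T), which is the integral of T over A
([integral_first_below]), by the integral of potential(X_0) over A. The inequality
holds for all such A, and this is the inequality almost surely between E[T | X_0]
and potential(X_0) ([ae_le_of_integral_le]). *)

(** * The concave potential of a nonincreasing rate *)

Section potential.
Context (R : realType) (k : R -> R).
Hypothesis k_ge0 : forall x, (0 <= k x)%R.
Hypothesis k_ni : nonincreasing_fun k.
Local Notation leb := (@lebesgue_measure R).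

(** The integral is over an empty set for x < 0, which keeps the function
nonnegative and monotone on the whole line. *)
Definition potential (x : R) : R :=
  fine (\int[leb]_(z in `[0%R, x]) (k z)%:E).

Let mk A : measurable A -> measurable_fun A (EFin \o k).
Proof. by move=> mA; apply/measurable_EFinP; exact: nonincreasing_measurable. Qed.

Let k_ge0E A : forall z, A z -> 0 <= (EFin \o k) z.
Proof. by move=> z _; rewrite lee_fin. Qed.

Lemma integral_itv_nonincreasing_bounds (b : bool) (x y : R) : (x <= y)%R ->
  ((y - x) * k y)%:E <= \int[leb]_(z in [set` Interval (BSide b x) (BRight y)]) (k z)%:E
    <= ((y - x) * k x)%:E.
Proof.
move=> xy; set I := [set` _].
have mI : measurable I by exact: measurable_itv.
have kI z : I z -> (k y <= k z)%R && (k z <= k x)%R.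
  rewrite /I /= itv_boundlr => /andP[xz zy].
  rewrite !k_ni//.
  by move: xz; case: (b); rewrite bnd_simp => // /ltW.
have Icst c : \int[leb]_(z in I) c%:E = ((y - x) * c)%:E.
  rewrite [LHS](integral_cst leb mI) [X in _ * X](lebesgue_measure_itv _)/=.
  have [xyl|] := ltP; first by rewrite -EFinB -EFinM mulrC.
  by rewrite lee_fin => yx; rewrite mule0 (@le_anti _ _ x y) ?xy// subrr mul0r.
rewrite -!Icst; apply/andP; split; apply: ge0_le_integral => //;
  by [exact: mk | move=> z _; rewrite lee_fin | move=> z /kI/andP[]; rewrite lee_fin].
Qed.

Lemma integral_potential x :
  (0 <= x)%R -> \int[leb]_(z in `[0%R, x]) (k z)%:E = (potential x)%:E.
Proof.
move=> x0; rewrite fineK//.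
have /andP[_ ub] := integral_itv_nonincreasing_bounds true x0.
rewrite ge0_fin_numE; first exact: le_lt_trans ub (ltry _).
by apply: integral_ge0; exact: k_ge0E.
Qed.

Lemma potential_ge0 x : (0 <= potential x)%R.
Proof. by apply: fine_ge0; apply: integral_ge0; exact: k_ge0E. Qed.

Lemma potentialB x y : (0 <= x)%R -> (x <= y)%R ->
  (potential y)%:E = (potential x)%:E + \int[leb]_(z in `]x, y]) (k z)%:E.
Proof.
move=> x0 xy; rewrite -!integral_potential//; last exact: le_trans xy.
rewrite -ge0_integral_setU//=.
- by congr integral; rewrite -itv_bndbnd_setU// bnd_simp.
- by apply: mk; apply: measurableU.
- by move=> z _; rewrite lee_fin.
rewrite disj_set2E; apply/eqP/seteqP; split => // z [] /=.
by rewrite !in_itv/= => /andP[_ zx] /andP[]; rewrite ltNge zx.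
Qed.

Lemma potential_nondecreasing : nondecreasing_fun potential.
Proof.
move=> x y xy; have [x0|x0] := leP 0%R x.
  by rewrite -lee_fin (potentialB x0 xy) leeDl//; apply: integral_ge0; exact: k_ge0E.
rewrite {1}/potential set_itv_ge ?integral_set0 ?bnd_simp ?potential_ge0//.
by rewrite -ltNge.
Qed.

Lemma measurable_potential : measurable_fun setT potential.
Proof. by apply: nondecreasing_measurable => //; exact: potential_nondecreasing. Qed.

(** The graph of the potential lies below its tangent of slope k x at x, because
k is at most k x to the right of x and at least k x to the left. The
inequality is arranged so that both sides are sums of nonnegative terms, which
can then be integrated without any integrability assumption. *)
Lemma potential_concave x y : (0 <= x)%R -> (0 <= y)%R ->
  (potential y + x * k x <= potential x + y * k x)%R.
Proof.
move=> x0 y0; have [xy|/ltW yx] := leP x y.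
- have /andP[_] := integral_itv_nonincreasing_bounds false xy.
  move/(leeD2l (potential x)%:E); rewrite -potentialB// -EFinD lee_fin.
  by rewrite mulrBl; lra.
- have /andP[+ _] := integral_itv_nonincreasing_bounds false yx.
  move/(leeD2l (potential y)%:E); rewrite -potentialB// -EFinD lee_fin.
  by rewrite mulrBl; lra.
Qed.

(** This is what makes the integral of x k(x) finite as soon as that of the potential
is. *)
Lemma ler_potential x : (0 <= x)%R -> (x * k x <= potential x)%R.
Proof.
move=> x0; have := potential_concave x0 (lexx 0%R).
by have := potential_ge0 0%R; lra.
Qed.

(** The constant value of k on the initial segment accounts for the summand
xmin / h(xmin) of the final bound. *)
Lemma potential_cst_prefix a x : (0 <= a)%R -> (a <= x)%R ->
  (forall z, (z <= a)%R -> k z = k a) ->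
  (potential x)%:E = (a * k a)%:E + \int[leb]_(z in `[a, x]) (k z)%:E.
Proof.
move=> a0 ax ka; rewrite (potentialB a0 ax) integral_itv_obnd_cbnd; last exact: mk.
congr (_ + _); rewrite -integral_potential//.
have /andP[lb ub] := integral_itv_nonincreasing_bounds true a0.
move: lb ub; rewrite subr0 (ka 0%R)// => lb ub.
by apply/eqP; rewrite eq_le lb ub.
Qed.
End potential.

(** * Integrals over a sub-sigma-algebra *)

Section sub_sigma_algebra_integrals.
Context d (W : measurableType d) (R : realType) (P : probability W R).
Variable G : set (set W).
Hypothesis Gm : G `<=` measurable.
Local Notation WG := (g_sigma_algebraType G).
Implicit Types (f Y : W -> \bar R) (A : set W).
Import HBNNSimple.

Lemma integral_mul_nnsfun f (u : {nnsfun WG >-> R}) A :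
  measurable_fun setT f -> (forall w, 0 <= f w) -> <<s G >> A ->
  \int[P]_(w in A) (f w * (u w)%:E) =
  \sum_(r \in range u) (r%:E * \int[P]_(w in A `&` u @^-1` [set r]) f w).
Proof.
move=> mf f0 /(sub_g_sigma_measurable Gm) mA.
have mu r : measurable (u @^-1` [set r] : set W).
  by apply: (sub_g_sigma_measurable Gm); exact: (@measurable_funPTI _ _ WG _ u).
transitivity (\int[P]_(w in A)
    \sum_(r \in range u) (f w * (r * \1_(u @^-1` [set r]) w)%:E)).
  apply: eq_integral => w _; rewrite (fimfunE u w) -fsumEFin//.
  by rewrite ge0_mule_fsumr// => r; exact: nnfun_muleindic_ge0.
have mfu r : measurable_fun A (fun w => f w * (\1_(u @^-1` [set r]) w)%:E).
  apply: emeasurable_funM; first exact: measurable_funTS.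
  by apply/measurable_EFinP; exact: measurable_funTS.
have fuE r w : f w * (r * \1_(u @^-1` [set r]) w)%:E =
    r%:E * (f w * (\1_(u @^-1` [set r]) w)%:E) by rewrite EFinM muleCA.
rewrite ge0_integral_fsum//; last 2 first.
- by move=> r; under eq_fun do rewrite fuE; exact: measurable_funeM.
- by move=> r w _; apply: mule_ge0 => //; exact: nnfun_muleindic_ge0.
apply: eq_fsbigr => r; rewrite inE => -[w0 _ <-].
under eq_integral do rewrite fuE.
rewrite ge0_integralZl//; last 2 first.
- by move=> w _; apply: mule_ge0; rewrite ?lee_fin.
- by rewrite lee_fin.
by rewrite integral_mkcondr; congr (_ * _); apply: eq_integral => w _; rewrite epatch_indic.
Qed.

(** Here f may take the value +oo, where multiplication is not continuous. At such
points the product still converges: either phi vanishes, and then so do its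
approximations from below, or the limit +oo * phi is not of the form oo * 0. *)
Lemma cvg_integral_mul_approx f (phi : W -> R) A
    (mphi : measurable_fun (setT : set WG) (EFin \o phi)) :
  measurable_fun setT f -> (forall w, 0 <= f w) -> (forall w, 0 <= phi w)%R ->
  <<s G >> A ->
  \int[P]_(w in A) (f w * (nnsfun_approx measurableT mphi n w)%:E) @[n --> \oo]
  --> \int[P]_(w in A) (f w * (phi w)%:E).
Proof.
move=> mf f0 phi0 /(sub_g_sigma_measurable Gm) mA.
set u := nnsfun_approx _ _.
have cvgu w : (u n w)%:E @[n --> \oo] --> (phi w)%:E.
  by apply: cvg_nnsfun_approx => // v _; rewrite /= lee_fin.
have ndu w a b : (a <= b)%N -> (u a w <= u b w)%R.
  by move=> ab; exact/lefP/nd_nnsfun_approx.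
have u_le n w : (u n w <= phi w)%R.
  rewrite -lee_fin -(cvg_lim _ (cvgu w))//.
  have nd : nondecreasing_seq (fun n => (u n w)%:E).
    by move=> a b ab; rewrite lee_fin ndu.
  rewrite (cvg_lim _ (ereal_nondecreasing_cvgn nd))//.
  by apply: ereal_sup_ubound; exists n.
have cvgfu w : f w * (u n w)%:E @[n --> \oo] --> f w * (phi w)%:E.
  case: (f w) (f0 w) => [r _| _ |//]; first exact: cvgeZl.
  have [phi_eq0|phi_neq0] := eqVneq (phi w) 0%R.
    rewrite phi_eq0 (_ : (fun n => _) = cst (+oo * 0%:E)); first exact: cvg_cst.
    apply/funext => n; congr (_ * _%:E); apply/eqP.
    by rewrite eq_le -{1}phi_eq0 u_le/=.
  apply: (@cvgeM _ _ _ _ (cst +oo)); [|exact: cvg_cst|exact: cvgu].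
  by apply: mule_def_infty_neq0; rewrite ?eqe.
have -> : \int[P]_(w in A) (f w * (phi w)%:E) =
    \int[P]_(w in A) limn (fun n => f w * (u n w)%:E).
  by apply: eq_integral => w _; rewrite (cvg_lim _ (cvgfu w)).
apply: cvg_monotone_convergence => //.
- move=> n; apply: emeasurable_funM; first exact: measurable_funTS.
  apply/measurable_EFinP; apply: measurable_funTS.
  by apply: (measurable_fun_g_sigma Gm).
- by move=> n w _; apply: mule_ge0; rewrite ?lee_fin.
- by move=> w _ a b ab; rewrite lee_wpmul2l// lee_fin ndu.
Qed.

(** The pull-out property in integrated form. Integrals of simple multipliers are
finite combinations of integrals over events of the sub-sigma-algebra, where f and
Y agree by definition; monotone convergence does the rest. *)
Lemma integral_cond_exp_mul f Y (phi : W -> R) A :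
  measurable_fun setT f -> (forall w, 0 <= f w) -> is_ge0_cond_exp P G f Y ->
  measurable_fun (setT : set WG) phi -> (forall w, 0 <= phi w)%R ->
  <<s G >> A ->
  \int[P]_(w in A) (Y w * (phi w)%:E) = \int[P]_(w in A) (f w * (phi w)%:E).
Proof.
move=> mf f0 [mY Y0 YE] mphi phi0 GA.
have mphi' : measurable_fun (setT : set WG) (EFin \o phi) by exact/measurable_EFinP.
have mY' : measurable_fun setT Y by exact: (measurable_fun_g_sigma Gm).
have cY := @cvg_integral_mul_approx _ _ _ mphi' mY' Y0 phi0 GA.
have cf := @cvg_integral_mul_approx _ _ _ mphi' mf f0 phi0 GA.
rewrite -(cvg_lim _ cY)// -(cvg_lim _ cf)//; congr (limn _); apply/funext => n.
rewrite !integral_mul_nnsfun//; apply: eq_fsbigr => r _; rewrite YE//.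
apply: (@measurableI _ WG) => //; exact: (@measurable_funPTI _ _ WG _ (u _)).
Qed.

(** The set where f exceeds Y is the union of the sets E n below. On E n the
function Y is bounded, so its integral is finite, and f exceeds Y by a fixed
positive amount, so the comparison of integrals forces E n to be null. *)
Lemma ae_le_of_integral_le f Y :
  measurable_fun (setT : set WG) f -> measurable_fun (setT : set WG) Y ->
  (forall w, 0 <= f w) -> (forall w, 0 <= Y w) ->
  (forall A, <<s G >> A -> \int[P]_(w in A) f w <= \int[P]_(w in A) Y w) ->
  {ae P, forall w, f w <= Y w}.
Proof.
move=> mf mY f0 Y0 fY.
have mf' := measurable_fun_g_sigma Gm mf.
have mY' := measurable_fun_g_sigma Gm mY.
pose E n : set WG :=
  [set w | Y w + (n.+1%:R^-1)%:E <= f w] `&` [set w | Y w <= n%:R%:E].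
have GE n : <<s G >> (E n).
  apply: (@measurableI _ WG).
    rewrite -[X in _ X]setTI; apply: emeasurable_fun_le => //.
    by apply: emeasurable_funD => //; exact: measurable_cst.
  rewrite -[X in _ X]setTI; exact: emeasurable_fun_infty_c.
have PE n : P (E n) = 0.
  have mE := sub_g_sigma_measurable Gm (GE n).
  have int_fin : \int[P]_(w in E n) Y w \is a fin_num.
    rewrite ge0_fin_numE ?integral_ge0//.
    apply: (@le_lt_trans _ _ (\int[P]_(w in E n) (cst n%:R%:E w))).
      apply: ge0_le_integral => //; first exact: measurable_funTS.
      by move=> w [].
    rewrite integral_cst// lte_mul_pinfty// ?lee_fin//.
    by apply: le_lt_trans (probability_le1 P mE) (ltry 1).
  have := fY _ (GE n).
  have : \int[P]_(w in E n) Y w + (n.+1%:R^-1)%:E * P (E n) <=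
         \int[P]_(w in E n) f w.
    rewrite -(integral_cst P mE) -ge0_integralD//; last 2 first.
    - exact: measurable_funTS.
    - by move=> w _; rewrite lee_fin.
    apply: ge0_le_integral => //.
    - by move=> w _; apply: adde_ge0; rewrite ?lee_fin.
    - by apply: emeasurable_funD; [exact: measurable_funTS|exact: measurable_cst].
    - exact: measurable_funTS.
    - by move=> w [].
  move=> /le_trans /[apply].
  rewrite -[leRHS]adde0 leeD2lE// pmule_rle0 ?lte_fin ?invr_gt0//.
  by move=> PE0; apply/eqP; rewrite eq_le PE0 measure_ge0.
have : {ae P, forall w : W, forall n, ~ E n w}.
  apply: ae_foralln => n; exists (E n); split; [|exact: PE|by move=> w /= /contrapT].
  exact: sub_g_sigma_measurable (GE n).
apply: filterS => w nE; rewrite leNgt; apply/negP => Yf.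
case Yw : (Y w) (Y0 w) Yf => [y| |] Yw0 yf; last 2 first.
- by move: yf; rewrite ltNge leey.
- by move: Yw0; rewrite leeNy_eq.
have [e e0 yef] : exists2 e : R, (0 < e)%R & y%:E + e%:E <= f w.
  case: (f w) yf => [r| |]//.
  - by rewrite lte_fin => yr; exists (r - y)%R; rewrite ?subr_gt0// -EFinD lee_fin subrKC.
  - by move=> _; exists 1%R; rewrite ?leey.
have [n [ny ne]] : exists n : nat, (y <= n%:R)%R /\ (n.+1%:R^-1 <= e)%R.
  exists (Num.truncn (Num.max y (e^-1)%R)).+1; split.
    by rewrite (le_trans _ (ltW (truncnS_gt _)))// le_max lexx.
  rewrite -[leRHS]invrK lef_pV2 ?posrE ?invr_gt0//.
  apply: (@le_trans _ _ (Num.truncn (Num.max y (e^-1)%R)).+1%:R); last by rewrite ler_nat.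
  by rewrite (le_trans _ (ltW (truncnS_gt _)))// le_max lexx orbT.
apply: (nE n); split; rewrite /= Yw.
  by apply: le_trans yef; rewrite leeD2l// lee_fin.
by rewrite lee_fin.
Qed.
End sub_sigma_algebra_integrals.

(** * Expected decrease of the potential in one step *)

Section drift_step.
Context d (W : measurableType d) (R : realType) (P : probability W R).
Variable G : set (set W).
Hypothesis Gm : G `<=` measurable.
Local Notation WG := (g_sigma_algebraType G).

(** The negative part of the next state vanishes only on an event of the history,
not everywhere, so the conditional expectation of the negative part has to be
localised. *)
Lemma ae_ge0_cond_exp_eq0 (f : W -> \bar R) A :
  measurable_fun setT f -> (forall w, 0 <= f w) -> <<s G >> A ->
  {ae P, forall w, A w -> f w = 0} ->
  {ae P, forall w, A w -> ge0_cond_exp P G f w = 0}.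
Proof.
move=> mf f0 GA fA0; have [mY Y0 YE] := ge0_cond_expP P Gm mf f0.
have mA := sub_g_sigma_measurable Gm GA.
have mYA : measurable_fun A (ge0_cond_exp P G f).
  by apply: measurable_funTS; exact: (measurable_fun_g_sigma Gm).
have [H _] := ae_eq_integral_abs P mA mYA; apply: H.
under eq_integral do rewrite gee0_abs//.
rewrite YE// (ae_eq_integral (cst 0))// ?integral0//.
exact: measurable_funTS.
Qed.

Context (k : R -> R).
Hypothesis k_ge0 : forall z, (0 <= k z)%R.
Hypothesis k_ni : nonincreasing_fun k.

(** One step of the process: x is the current state, y the next one, G generates
the history, and A is an event of the history on which the process is still
alive. There k(x) is the reciprocal of the required drift. *)
Lemma potential_drift (x y : W -> R) A :
  measurable_fun (setT : set WG) x -> measurable_fun setT y -> <<s G >> A ->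
  (forall w, A w -> (0 <= x w)%R) -> (forall w, A w -> (0 < k (x w))%R) ->
  {ae P, forall w, A w -> (0 <= y w)%R} ->
  {ae P, forall w, A w ->
    ((k (x w))^-1)%:E <= (x w)%:E - cond_exp P G (EFin \o y) w} ->
  \int[P]_(w in A) (potential k (y w))%:E + P A <=
  \int[P]_(w in A) (potential k (x w))%:E.
Proof.
move=> mx my GA x0 kx0 y0 drift.
have mA := sub_g_sigma_measurable Gm GA.
have mx' := measurable_fun_g_sigma Gm mx.
have mEy : measurable_fun setT (EFin \o y) by exact/measurable_EFinP.
set f := (EFin \o y)^\+; pose Y := ge0_cond_exp P G f.
have mf : measurable_fun setT f by exact: measurable_funepos.
have f0 w : 0 <= f w by exact: funepos_ge0.
have mfn : measurable_fun setT (EFin \o y)^\- by exact: measurable_funeneg.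
have YP : is_ge0_cond_exp P G f Y by exact: (ge0_cond_expP P Gm mf).
have [mY Y0 YE] := YP.
have mY' := measurable_fun_g_sigma Gm mY.
have mk : measurable_fun setT k by exact: nonincreasing_measurable.
have mp : measurable_fun setT (potential k) by exact: measurable_potential.
have Yn0 : {ae P, forall w, A w -> ge0_cond_exp P G (EFin \o y)^\- w = 0}.
  apply: ae_ge0_cond_exp_eq0 => //.
  apply: filterS y0 => w /[apply] yw0.
  by rewrite funenegE/= max_r// lee_fin oppr_le0.
have m1 : measurable_fun A (fun w => (potential k (x w))%:E).
  by apply/measurable_EFinP; apply: measurableT_comp => //; exact: measurable_funTS.
have m2 : measurable_fun A (fun w => (potential k (y w))%:E).
  by apply/measurable_EFinP; apply: measurableT_comp => //; exact: measurable_funTS.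
have m3 : measurable_fun A (fun w => (x w * k (x w))%:E).
  apply/measurable_EFinP; apply: measurable_funM; first exact: measurable_funTS.
  by apply: measurableT_comp => //; exact: measurable_funTS.
have m4 : measurable_fun A (fun w => (k (x w))%:E).
  by apply/measurable_EFinP; apply: measurableT_comp => //; exact: measurable_funTS.
have m5 : measurable_fun A (fun w => f w * (k (x w))%:E).
  by apply: emeasurable_funM => //; exact: measurable_funTS.
have m6 : measurable_fun A (fun w => Y w * (k (x w))%:E).
  by apply: emeasurable_funM => //; exact: measurable_funTS.
have xk0 w : A w -> 0 <= (x w * k (x w))%:E.
  by move=> /x0 xw0; rewrite lee_fin mulr_ge0.
have p0 z : 0 <= (potential k z)%:E by rewrite lee_fin potential_ge0.
have fk0 w : 0 <= f w * (k (x w))%:E.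
  by rewrite mule_ge0 ?lee_fin.
have Yk0 w : 0 <= Y w * (k (x w))%:E by rewrite mule_ge0 ?lee_fin.
have concave : \int[P]_(w in A) (potential k (y w))%:E +
      \int[P]_(w in A) (x w * k (x w))%:E <=
    \int[P]_(w in A) (potential k (x w))%:E +
      \int[P]_(w in A) (Y w * (k (x w))%:E).
  rewrite (integral_cond_exp_mul Gm mf _ YP)//; last first.
    exact: measurableT_comp mx.
  rewrite -!ge0_integralD//.
  apply: ae_ge0_le_integral => //.
  - by move=> w Aw; rewrite adde_ge0// xk0.
  - exact: emeasurable_funD.
  - by move=> w Aw; rewrite adde_ge0.
  - exact: emeasurable_funD.
  apply: filterS y0 => w /[swap] Aw /(_ Aw) yw0.
  rewrite /f funeposE/= max_l ?lee_fin//.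
  by apply: potential_concave => //; exact: x0.
have decrease : \int[P]_(w in A) (Y w * (k (x w))%:E) + P A <=
    \int[P]_(w in A) (x w * k (x w))%:E.
  rewrite -[P A]mul1e -(integral_cst P mA) -ge0_integralD//.
  apply: ae_ge0_le_integral => //.
  - by move=> w Aw; rewrite adde_ge0 //= lee_fin.
  - by apply: emeasurable_funD => //; exact: measurable_cst.
  apply: filterS2 Yn0 drift => w /[swap] + /[swap] Aw => /(_ Aw) + /(_ Aw) Yn.
  rewrite /cond_exp -/f -/Y Yn sube0.
  have kw := kx0 _ Aw.
  (* The value +oo of Y is excluded by the drift bound, which would be at most -oo. *)
  case: (Y w) (Y0 w) => [r _| |]//=.
  rewrite -EFinB lee_fin => kr; rewrite -EFinM -EFinD lee_fin.
  by rewrite -(mulVf (lt0r_neq0 kw)) -mulrDl ler_pM2r//; lra.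
(* The integral of x k(x) cancels only if it is finite; otherwise it forces the
right-hand side to be infinite. *)
have [xk_oo|xk_fin] := eqVneq (\int[P]_(w in A) (x w * k (x w))%:E) +oo.
  rewrite [leRHS](_ : _ = +oo) ?leey//; apply/eqP; rewrite -leye_eq -xk_oo.
  by apply: ge0_le_integral => // w Aw; rewrite lee_fin ler_potential// x0.
rewrite -(@leeD2rE _ (\int[P]_(w in A) (x w * k (x w))%:E)).
  rewrite addeAC; apply: le_trans (leeD2r _ concave) _.
  by rewrite -addeA leeD2l.
by rewrite ge0_fin_numE ?integral_ge0// ltey.
Qed.
End drift_step.

(** * The reciprocal drift *)

Section reciprocal_drift.
Context (R : realType) (D : set R) (a : R) (h : R -> R).
Hypothesis D_itv : is_interval D.
Hypothesis Da : D a.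
Hypothesis h_gt0 : forall x, D x -> (0 < h x)%R.
Hypothesis h_nd : forall x y, D x -> D y -> (x <= y)%R -> (h x <= h y)%R.

(** The drift h is only controlled on D. The two extensions make the reciprocal
monotone on the whole line, hence measurable. *)
Definition reciprocal_drift (z : R) : R :=
  if (z <= a)%R then (h a)^-1%R else if `[< D z >] then (h z)^-1%R else 0%R.

Lemma reciprocal_driftE z : D z -> (a <= z)%R -> reciprocal_drift z = (h z)^-1%R.
Proof.
move=> Dz az; rewrite /reciprocal_drift; case: ifPn => za.
  by congr (h _)^-1%R; apply/le_anti; rewrite az za.
by rewrite asboolT.
Qed.

Lemma reciprocal_drift_ge0 z : (0 <= reciprocal_drift z)%R.
Proof.
rewrite /reciprocal_drift; case: ifP => _; first by rewrite invr_ge0 ltW// h_gt0.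
by case: asboolP => // Dz; rewrite invr_ge0 ltW// h_gt0.
Qed.

Lemma reciprocal_drift_nonincreasing : nonincreasing_fun reciprocal_drift.
Proof.
move=> x y xy; have [ya|ay] := leP y a.
  by rewrite /reciprocal_drift ya (le_trans xy ya).
rewrite {1}/reciprocal_drift (leNgt y a) ay/=.
case: asboolP => [Dy|_]; last exact: reciprocal_drift_ge0.
rewrite /reciprocal_drift; case: ifPn => [_|].
  by rewrite lef_pV2 ?posrE ?h_gt0//; apply: h_nd => //; exact: ltW.
rewrite -ltNge => ax; have Dx : D x by apply: (D_itv Da Dy); rewrite (ltW ax).
by rewrite asboolT// lef_pV2 ?posrE ?h_gt0//; exact: h_nd.
Qed.

Lemma potential_reciprocal_drift x : (0 <= a)%R -> (a <= x)%R -> D x ->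
  (potential reciprocal_drift x)%:E =
  (a / h a)%:E + \int[lebesgue_measure]_(z in `[a, x]) ((h z)^-1)%:E.
Proof.
move=> a0 ax Dx; rewrite (@potential_cst_prefix _ reciprocal_drift _ _ a)//.
- rewrite reciprocal_driftE//; congr (_ + _); apply: eq_integral => z.
  rewrite inE/= in_itv/= => /andP[az zx]; rewrite reciprocal_driftE//.
  by apply: (D_itv Da Dx); rewrite az.
- exact: reciprocal_drift_ge0.
- exact: reciprocal_drift_nonincreasing.
- by move=> z za; rewrite /reciprocal_drift za lexx.
Qed.
End reciprocal_drift.

(** * Telescoping and the hitting time *)

(** The additive drift argument: v is the remaining expected potential and p the
expected cost of a step. *)
Lemma nneseries_le_of_decrease (R : realType) (v p : nat -> \bar R) :
  (forall t, 0 <= v t) -> (forall t, 0 <= p t) ->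
  (forall t, v t.+1 + p t <= v t) -> \sum_(t <oo) p t <= v 0%N.
Proof.
move=> v0 p0 vp; apply: lime_le; first exact: is_cvg_nneseries.
apply: nearW => n; suff : v n + \sum_(0 <= t < n) p t <= v 0%N.
  by apply: le_trans; rewrite leeDr.
elim: n => [|n IH]; first by rewrite big_geq// adde0.
rewrite big_nat_recr//= addeCA; apply: le_trans IH.
by rewrite [leRHS]addeC leeD2l.
Qed.

Section first_below.
Context d (W : measurableType d) (R : realType) (P : probability W R).
Variables (X : nat -> {RV P >-> R}) (a : R).
Local Notation T := (first_below X a).

Lemma lt_first_below t w :
  (t%:R%:E < T w) <-> (forall i, (i <= t)%N -> (a <= X i w)%R).
Proof.
split=> [tT i it|aX].
  rewrite leNgt; apply/negP => Xa; move: tT; rewrite ltNge => /negP; apply.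
  apply: (@le_trans _ _ i%:R%:E); last by rewrite lee_fin ler_nat.
  by apply: ereal_inf_lbound; exists i.
apply: (@lt_le_trans _ _ t.+1%:R%:E); first by rewrite lte_fin ltr_nat.
apply: le_ereal_inf_tmp => _ [s /= Xs <-]; rewrite lee_fin ler_nat ltnNge.
by apply/negP => /aX; rewrite leNgt Xs.
Qed.

Lemma first_below_ge0 w : 0 <= T w.
Proof. by apply: le_ereal_inf_tmp => _ [s _ <-]; rewrite lee_fin. Qed.

Definition alive t : set W := [set w | t%:R%:E < T w].

Lemma subset_alive t : alive t.+1 `<=` alive t.
Proof.
by move=> w /lt_first_below aX; apply/lt_first_below => i it; apply: aX; exact: leqW.
Qed.

(** A time with values in the extended naturals is the number of instants strictly
before it. This gives both the measurability of the hitting time and the layer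
formula for its integral. *)
Lemma first_below_series w : T w = \sum_(t <oo) (\1_(alive t) w)%:E.
Proof.
have [[n Xn]|noX] := pselect (exists n, (X n w < a)%R).
  have [m Xm m_min] := @ex_minnP (fun n => (X n w < a)%R) (ex_intro _ n Xn).
  have TE : T w = m%:R%:E.
    apply/eqP; rewrite eq_le; apply/andP; split.
      by apply: ereal_inf_lbound; exists m.
    by apply: le_ereal_inf_tmp => _ [s /= Xs <-]; rewrite lee_fin ler_nat m_min.
  apply/esym; rewrite TE; apply: lim_near_cst => //; near=> N.
  have mN : (m <= N)%N by near: N; exists m.
  rewrite sumEFin (big_cat_nat (leq0n m) mN)//= [X in (_ + X)%R]big1_seq ?addr0.
    rewrite (eq_big_nat _ _ (F2 := fun _ => 1%R)); last first.
      by move=> i /andP[_ im]; rewrite indicE mem_set// /alive/= TE lte_fin ltr_nat.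
    by rewrite big_const_nat subn0 iter_addr_0.
  move=> i; rewrite mem_index_iota => /andP[_ /andP[mi _]].
  by rewrite indicE memNset// /alive/= TE lte_fin ltr_nat ltnNge mi.
have TE : T w = +oo.
  rewrite /first_below (_ : [set t | (X t w < a)%R] = set0) ?image_set0 ?ereal_inf0//.
  by apply/seteqP; split => // n Xn; apply: noX; exists n.
rewrite TE; apply/esym/cvg_lim => //; rewrite (_ : (fun _ => _) = fun n => (n%:R : R)%:E).
  exact/cvgenyP.
apply/funext => n; rewrite sumEFin; congr EFin.
under eq_bigr do rewrite indicE mem_set ?TE /alive/= ?TE ?ltry//.
by rewrite big_const_nat subn0 iter_addr_0.
Unshelve. all: by end_near. Qed.

Lemma measurable_history t i : (i <= t)%N ->
  measurable_fun (setT : set (g_sigma_algebraType (history X t))) (X i : W -> R).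
Proof.
move=> it _ B mB; apply: sub_sigma_algebra; apply: sub_sigma_algebra.
rewrite -bigcup_mkord_ord; exists i => //.
by exists B => //; rewrite inordK.
Qed.

(** Being alive at time t depends only on the states up to t, so the drift
condition at time t may be integrated over this event. *)
Lemma history_alive t : <<s history X t >> (alive t).
Proof.
rewrite (_ : alive t = \bigcap_(i in `I_t.+1) [set w | (a <= X i w)%R]).
  apply: (@bigcap_measurable _ (g_sigma_algebraType (history X t))) => //.
    by exists 0%N.
  move=> i /= it; rewrite -[X in measurable X]setTI.
  have := @measurable_history t i it measurableT `[a, +oo[%classic (measurable_itv _).
  by congr measurable; congr (_ `&` _); apply/seteqP; split=> w /=; rewrite in_itv/= andbT.
apply/seteqP; split=> w; first by move=> /lt_first_below aX i /= it; exact: aX.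
by move=> aX; apply/lt_first_below => i it; exact: aX.
Qed.

Lemma measurable_alive t : measurable (alive t).
Proof.
exact: (sub_g_sigma_measurable (@history_measurable _ _ _ _ X t) (@history_alive t)).
Qed.

Lemma measurable_first_below : measurable_fun setT T.
Proof.
rewrite (_ : T = fun w => \sum_(t <oo) (\1_(alive t) w)%:E); last first.
  by apply/funext => w; exact: first_below_series.
apply: ge0_emeasurable_sum => t; first by move=> *; rewrite lee_fin.
move=> _.
by apply/measurable_EFinP/measurable_indic; exact: measurable_alive.
Qed.

Lemma integral_first_below A : measurable A ->
  \int[P]_(w in A) T w = \sum_(t <oo) P (A `&` alive t).
Proof.
move=> mA; under eq_integral do rewrite first_below_series.
rewrite integral_nneseries//; last first.
  by move=> t; apply/measurable_EFinP/measurable_indic; exact: measurable_alive.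
apply: eq_eseriesr => t _; rewrite integral_indic//; last exact: measurable_alive.
by rewrite setIC.
Qed.

End first_below.

(** * The drift domain *)

Section drift_domain.
Context d (W : measurableType d) (R : realType) (P : probability W R).
Variables (X : nat -> {RV P >-> R}) (a : R).

Lemma is_interval_drift_domain : is_interval (drift_domain X a).
Proof.
move=> x y Dx Dy z xzy M MP; have [Mitv _] := MP.
exact: (Mitv x y (Dx M MP) (Dy M MP)).
Qed.

Lemma drift_domain_min : drift_domain X a a.
Proof. by apply: sub_gen_smallest; left. Qed.

Lemma drift_domain_reachable t w :
  t%:R%:E <= first_below X a w -> (a <= X t w)%R -> drift_domain X a (X t w).
Proof. by move=> tT aX; apply: sub_gen_smallest; right; split => //; exists t, w. Qed.
End drift_domain.

(** * The variable drift bound *)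

Lemma preimage_history d (W : measurableType d) (R : realType)
    (P : probability W R) (X : nat -> {RV P >-> R}) t A :
  <<s g_sigma_algebra_preimage (X 0%N) >> A -> <<s history X t >> A.
Proof.
apply: smallest_sub; first exact: smallest_sigma_algebra.
by move=> _ [B mB <-]; exact: (@measurable_history _ _ _ _ X t 0%N (leq0n t) measurableT B mB).
Qed.

Theorem theorem9 (d : measure_display) (W : measurableType d) (R : realType)
    (P : probability W R) (X : nat -> {RV P >-> R}) (xmin : R) (h : R -> R) :
  let T := first_below X xmin in
  let D := drift_domain X xmin in
  (0 < xmin)%R ->
  {ae P, forall w, (xmin <= X 0%N w)%R} ->
  (forall t : nat, {ae P, forall w, (t%:R)%:E <= T w -> (0 <= X t w)%R}) ->
  (forall x, D x -> (0 < h x)%R) ->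
  (forall x y, D x -> D y -> (x <= y)%R -> (h x <= h y)%R) ->
  (forall t : nat, {ae P, forall w, (t%:R)%:E < T w ->
     (h (X t w))%:E <=
     (X t w)%:E - cond_exp P (history X t) (fun w' => (X t.+1 w')%:E) w}) ->
  {ae P, forall w,
     cond_exp P (g_sigma_algebra_preimage (X 0%N)) T w <=
     (xmin / h xmin)%:E +
     \int[lebesgue_measure]_(z in `[xmin, X 0%N w]) ((h z)^-1)%:E}.
Proof.
move=> T D xmin_gt0 X0_ge X_ge0 h_gt0 h_nd drift.
have D_itv : is_interval D by exact: is_interval_drift_domain.
have D_min : D xmin by exact: drift_domain_min.
pose k := reciprocal_drift D xmin h.
have k_ge0 : forall z, (0 <= k z)%R by exact: reciprocal_drift_ge0.
have k_ni : nonincreasing_fun k by exact: reciprocal_drift_nonincreasing.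
have mpot : measurable_fun setT (potential k) by exact: measurable_potential.
set G0 := g_sigma_algebra_preimage (X 0%N).
have mG0 : G0 `<=` measurable.
  by move=> _ [B mB <-]; exact: (measurable_funP (X 0%N) measurableT).
have alive_ge t w : alive X xmin t w -> (xmin <= X t w)%R.
  by move=> /lt_first_below; exact.
have aliveD t w : alive X xmin t w -> D (X t w).
  by move=> tT; apply: drift_domain_reachable; [exact: ltW|exact: alive_ge].
pose V A t := \int[P]_(w in A `&` alive X xmin t) (potential k (X t w))%:E.
have mpotX t : measurable_fun setT (fun w => (potential k (X t w))%:E).
  by apply/measurable_EFinP; exact: measurableT_comp.
have potX_ge0 t w : 0 <= (potential k (X t w))%:E.
  by rewrite lee_fin potential_ge0.
have decrease A t : <<s G0 >> A ->
    V A t.+1 + P (A `&` alive X xmin t) <= V A t.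
  move=> GA; have mA := sub_g_sigma_measurable mG0 GA.
  apply: (@le_trans _ _ (\int[P]_(w in A `&` alive X xmin t)
      (potential k (X t.+1 w))%:E + P (A `&` alive X xmin t))).
    (* Discarding the paths that die at t + 1 only loses nonnegative potential. *)
    rewrite leeD2r//; apply: ge0_subset_integral => //.
    - by apply: measurableI => //; exact: measurable_alive.
    - by apply: measurableI => //; exact: measurable_alive.
    - exact: measurable_funTS.
    - by apply: setIS; exact: subset_alive.
  apply: (potential_drift (@history_measurable _ _ _ _ X t)) => //.
  - exact: measurable_history.
  - apply: (@measurableI _ (g_sigma_algebraType (history X t))).
      exact: preimage_history.
    exact: history_alive.
  - by move=> w [_ /alive_ge]; apply: le_trans; exact: ltW.
  - move=> w [_ tT]; rewrite /k reciprocal_driftE ?invr_gt0 ?h_gt0//;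
      by [exact: aliveD|exact: alive_ge].
  (* Being alive at t means t + 1 <= T, where the next state is nonnegative. *)
  - apply: filterS (X_ge0 t.+1) => w Xw [_ tT]; apply: Xw.
    apply: le_ereal_inf_tmp => _ [s /= Xs <-]; rewrite lee_fin ler_nat ltnNge.
    by apply/negP => st; move: Xs; rewrite ltNge (lt_first_below X xmin t w).1.
  - apply: filterS (drift t) => w Xw [_ tT].
    by rewrite /k reciprocal_driftE ?invrK ?Xw//; [exact: aliveD|exact: alive_ge].
have T_le A : <<s G0 >> A ->
    \int[P]_(w in A) T w <= \int[P]_(w in A) (potential k (X 0%N w))%:E.
  move=> GA; have mA := sub_g_sigma_measurable mG0 GA.
  rewrite integral_first_below//; apply: (@le_trans _ _ (V A 0%N)).
    apply: nneseries_le_of_decrease => // [t|t].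
      by apply: integral_ge0 => w _; exact: potX_ge0.
    exact: decrease.
  apply: ge0_subset_integral => //.
    by apply: measurableI => //; exact: measurable_alive.
  exact: measurable_funTS.
have TE : T^\+ = T.
  apply/funext => w; rewrite funeposE max_l//; exact: first_below_ge0.
have mT : measurable_fun setT T by exact: measurable_first_below.
have T0 w : 0 <= T w by exact: first_below_ge0.
have [mY Y0 YE] := ge0_cond_expP P mG0 mT T0.
have [_ Yn0 _] := ge0_cond_expP P mG0 (measurable_funeneg mT) (funeneg_ge0 T).
have Y_le : {ae P, forall w, ge0_cond_exp P G0 T w <= (potential k (X 0%N w))%:E}.
  apply: (ae_le_of_integral_le mG0) => //.
    apply/measurable_EFinP; apply: measurableT_comp => //.
    by move=> _ B mB; apply: sub_sigma_algebra; exists B.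
  by move=> A GA; rewrite YE// T_le.
apply: filterS2 Y_le X0_ge => w Y_le X0_ge.
rewrite -(potential_reciprocal_drift D_itv)//; [|exact: ltW|]; last first.
  exact: drift_domain_reachable.
apply: le_trans Y_le; rewrite /cond_exp TE.
by rewrite geeDl// oppe_le0.
Qed.
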